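(* Let $(M^n,g)$, $n\ge 3$, be a Riemannian manifold with Levi-Civita connection $\nabla$, let $\pi$ be a 1-form on $M$ with associated vector field $P$ (that is, $g(X,P)=\pi(X)$ for all $X$), and let $\bar\nabla$ be the semi-symmetric metric connection determined by $\pi$. Suppose that the generator $P$ is a Killing vector field with respect to $\nabla$. If $(M^n,\nabla)$ is an Einstein manifold, then $(M^n,\bar\nabla)$ is a semi-quasi-Einstein manifold $S(QE^n)$.
   Context: The semi-symmetric metric connection determined by $\pi$ is $\bar\nabla_XY=\nabla_XY+\pi(Y)X-g(X,Y)P$; $P$ is called the generator of $(M^n,\bar\nabla)$. Its curvature is $\bar R(X,Y)Z=\bar\nabla_X\bar\nabla_YZ-\bar\nabla_Y\bar\nabla_XZ-\bar\nabla_{[X,Y]}Z$ and its Ricci tensor is $\bar S(Y,Z)=\operatorname{tr}(X\mapsto \bar R(X,Y)Z)$, which in general is not symmetric; $R$ and $S$ denote the corresponding curvature and Ricci tensor of $\nabla$. Put $\hat S(Y,Z)=\frac12\{\bar S(Y,Z)+\bar S(Z,Y)\}$. $(M^n,\nabla)$ is Einstein if $S(X,Y)=a\,g(X,Y)$ for a scalar $a$. $P$ is Killing if $g(\nabla_XP,Y)+g(\nabla_YP,X)=0$ for all $X,Y$. $(M^n,\bar\nabla)$, $n\ge 3$, is called a semi-quasi-Einstein manifold, written $S(QE^n)$, if its (symmetrized) Ricci tensor $\hat S$ is non-zero (not identically zero) and has the form $\hat S(Y,Z)=a\,g(Y,Z)+b\,\eta(Y)\eta(Z)$ for some scalar functions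 $a,b$ and some non-zero 1-form $\eta$.
   Formalization: The case where π vanishes identically and ∇ is Ricci-flat (S = 0) is excluded, since there the symmetrized Ricci tensor is identically zero and the manifold is not S(QE^n), as for flat R^n with π = 0. *)

(* Defs.v *)
From HB Require Import structures.
From mathcomp Require Import all_boot all_order all_algebra.
From mathcomp Require Import all_classical all_reals all_analysis.

Set Implicit Arguments.
Unset Strict Implicit.
Unset Printing Implicit Defensive.

Import Order.TTheory GRing.Theory Num.Theory.
Import numFieldNormedType.Exports.

Local Open Scope classical_set_scope.
Local Open Scope ring_scope.

(* In finite dimension, the derivative x |-> 'd f x is k times differentiable  *)
(* iff all the directional derivatives x |-> 'D_v f x are.                     *)
Fixpoint kdiff_on (R : realType) (V W : normedModType R) (k : nat) (U : set V)
    (f : V -> W) : Prop :=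
  if k is k'.+1 then
    (forall x, U x -> differentiable f x) /\
    (forall v, kdiff_on k' U ('D_v f))
  else True.

Definition smooth_on (R : realType) (V W : normedModType R) (U : set V)
    (f : V -> W) : Prop :=
  forall k, kdiff_on k U f.

(* cmap is only meaningful on cdom, and cinv on the image of cdom. *)
Record chart (R : realType) (n : nat) (M : topologicalType) : Type := Chart {
  cdom : set M;
  cmap : M -> 'rV[R]_n;
  cinv : 'rV[R]_n -> M;
  cdom_open : open cdom;
  cimg_open : open (cmap @` cdom);
  cmapK : forall p, cdom p -> cinv (cmap p) = p;
  cmap_continuous : forall p, cdom p -> {for p, continuous cmap};
  cinv_continuous : forall x, (cmap @` cdom) x -> {for x, continuous cinv} }.

(* A smooth structure on M, given by a (not necessarily maximal) smooth atlas. *)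
(* chart_at singles out a chart around each point; it only serves to represent *)
(* the elements of the tangent space T_p M by their coordinates, see below.    *)
Record smooth_manifold (R : realType) (n : nat) (M : topologicalType) : Type :=
  SmoothManifold {
    manifold_hausdorff : hausdorff_space M;
    manifold_second_countable : @second_countable M;
    atlas : set (chart R n M);
    atlas_smooth : forall c c', atlas c -> atlas c' ->
      smooth_on (cmap c @` (cdom c `&` cdom c')) (cmap c' \o cinv c);
    chart_at : M -> chart R n M;
    chart_at_atlas : forall p, atlas (chart_at p);
    chart_at_dom : forall p, cdom (chart_at p) p }.

(* Tensors at p are given by their coordinates in the chart chart_at p: T_p M  *)
(* is 'rV[R]_n, its dual is 'cV[R]_n and bilinear forms on T_p M are 'M[R]_n.  *)
(* Coordinates of tangent vectors at p in c become coordinates in c' by        *)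
(* right multiplication by the Jacobian matrix change c c' p.                  *)
Definition change (R : realType) (n : nat) (M : topologicalType)
    (c c' : chart R n M) (p : M) : 'M[R]_n :=
  'J (cmap c' \o cinv c) (cmap c p).

Definition vector_in (R : realType) (n : nat) (M : topologicalType)
    (A : smooth_manifold R n M) (X : M -> 'rV[R]_n) (c : chart R n M) (p : M) :
    'rV[R]_n :=
  X p *m change (chart_at A p) c p.

Definition covector_in (R : realType) (n : nat) (M : topologicalType)
    (A : smooth_manifold R n M) (w : M -> 'cV[R]_n) (c : chart R n M) (p : M) :
    'cV[R]_n :=
  change c (chart_at A p) p *m w p.

Definition bilinear_in (R : realType) (n : nat) (M : topologicalType)
    (A : smooth_manifold R n M) (g : M -> 'M[R]_n) (c : chart R n M) (p : M) :
    'M[R]_n :=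
  change c (chart_at A p) p *m g p *m (change c (chart_at A p) p)^T.

Definition smooth_in_charts (R : realType) (n : nat) (M : topologicalType)
    (A : smooth_manifold R n M) (W : normedModType R)
    (T : chart R n M -> M -> W) : Prop :=
  forall c, atlas A c -> smooth_on (cmap c @` cdom c) (T c \o cinv c).

Definition smooth_function (R : realType) (n : nat) (M : topologicalType)
    (A : smooth_manifold R n M) (f : M -> R) : Prop :=
  smooth_in_charts A (fun _ => f).

Definition vector_field (R : realType) (n : nat) (M : topologicalType)
    (A : smooth_manifold R n M) (X : M -> 'rV[R]_n) : Prop :=
  smooth_in_charts A (vector_in A X).

Definition one_form (R : realType) (n : nat) (M : topologicalType)
    (A : smooth_manifold R n M) (w : M -> 'cV[R]_n) : Prop :=
  smooth_in_charts A (covector_in A w).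

Definition pairing (R : realType) (n : nat) (M : topologicalType)
    (w : M -> 'cV[R]_n) (X : M -> 'rV[R]_n) (p : M) : R :=
  (X p *m w p) 0 0.

Definition inner (R : realType) (n : nat) (M : topologicalType)
    (g : M -> 'M[R]_n) (X Y : M -> 'rV[R]_n) (p : M) : R :=
  (X p *m g p *m (Y p)^T) 0 0.

Record riemannian_metric (R : realType) (n : nat) (M : topologicalType)
    (A : smooth_manifold R n M) (g : M -> 'M[R]_n) : Prop := RiemannianMetric {
  metric_sym : forall p, (g p)^T = g p;
  metric_pos : forall p (v : 'rV[R]_n), v != 0 -> 0 < (v *m g p *m v^T) 0 0;
  metric_smooth : smooth_in_charts A (bilinear_in A g) }.

Definition derivation (R : realType) (n : nat) (M : topologicalType)
    (A : smooth_manifold R n M) (X : M -> 'rV[R]_n) (f : M -> R) (p : M) : R :=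
  'D_(X p) (f \o cinv (chart_at A p)) (cmap (chart_at A p) p).

(* [X, Y]^i = X^j d_j Y^i - Y^j d_j X^i in the chart chart_at p *)
Definition lie_bracket (R : realType) (n : nat) (M : topologicalType)
    (A : smooth_manifold R n M) (X Y : M -> 'rV[R]_n) (p : M) : 'rV[R]_n :=
  let c := chart_at A p in
  'D_(X p) (vector_in A Y c \o cinv c) (cmap c p)
  - 'D_(Y p) (vector_in A X c \o cinv c) (cmap c p).

(* Only the values D X Y at (smooth) vector fields X and Y are constrained. *)
Record affine_connection (R : realType) (n : nat) (M : topologicalType)
    (A : smooth_manifold R n M)
    (D : (M -> 'rV[R]_n) -> (M -> 'rV[R]_n) -> M -> 'rV[R]_n) : Prop :=
  AffineConnection {
    connection_smooth : forall X Y, vector_field A X -> vector_field A Y ->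
      vector_field A (D X Y);
    connection_addl : forall X X' Y,
      vector_field A X -> vector_field A X' -> vector_field A Y ->
      forall p, D (fun q => X q + X' q) Y p = D X Y p + D X' Y p;
    connection_addr : forall X Y Y',
      vector_field A X -> vector_field A Y -> vector_field A Y' ->
      forall p, D X (fun q => Y q + Y' q) p = D X Y p + D X Y' p;
    connection_scalel : forall f X Y,
      smooth_function A f -> vector_field A X -> vector_field A Y ->
      forall p, D (fun q => f q *: X q) Y p = f p *: D X Y p;
    connection_leibniz : forall f X Y,
      smooth_function A f -> vector_field A X -> vector_field A Y ->
      forall p, D X (fun q => f q *: Y q) p =
        derivation A X f p *: Y p + f p *: D X Y p }.

Record levi_civita (R : realType) (n : nat) (M : topologicalType)
    (A : smooth_manifold R n M) (g : M -> 'M[R]_n)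
    (D : (M -> 'rV[R]_n) -> (M -> 'rV[R]_n) -> M -> 'rV[R]_n) : Prop :=
  LeviCivita {
    levi_civita_connection : affine_connection A D;
    levi_civita_torsion_free : forall X Y,
      vector_field A X -> vector_field A Y ->
      forall p, D X Y p - D Y X p = lie_bracket A X Y p;
    levi_civita_metric : forall X Y Z,
      vector_field A X -> vector_field A Y -> vector_field A Z ->
      forall p, derivation A X (inner g Y Z) p =
        inner g (D X Y) Z p + inner g Y (D X Z) p }.

Definition semi_symmetric (R : realType) (n : nat) (M : topologicalType)
    (g : M -> 'M[R]_n) (pi : M -> 'cV[R]_n) (P : M -> 'rV[R]_n)
    (D : (M -> 'rV[R]_n) -> (M -> 'rV[R]_n) -> M -> 'rV[R]_n)
    (X Y : M -> 'rV[R]_n) (p : M) : 'rV[R]_n :=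
  D X Y p + pairing pi Y p *: X p - inner g X Y p *: P p.

Definition curvature (R : realType) (n : nat) (M : topologicalType)
    (A : smooth_manifold R n M)
    (D : (M -> 'rV[R]_n) -> (M -> 'rV[R]_n) -> M -> 'rV[R]_n)
    (X Y Z : M -> 'rV[R]_n) (p : M) : 'rV[R]_n :=
  D X (D Y Z) p - D Y (D X Z) p - D (lie_bracket A X Y) Z p.

(* Such a field exists: cut off a field that is constant in a chart around p.  *)
Definition extension (R : realType) (n : nat) (M : topologicalType)
    (A : smooth_manifold R n M) (p : M) (v : 'rV[R]_n) : M -> 'rV[R]_n :=
  xget (fun=> 0) [set X | vector_field A X /\ X p = v].

(* The trace of the endomorphism X p |-> (D-curvature (X, Y) Z) p of T_p M. As *)
(* the curvature of a connection is tensorial, the extensions do not matter.   *)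
Definition ricci (R : realType) (n : nat) (M : topologicalType)
    (A : smooth_manifold R n M)
    (D : (M -> 'rV[R]_n) -> (M -> 'rV[R]_n) -> M -> 'rV[R]_n)
    (Y Z : M -> 'rV[R]_n) (p : M) : R :=
  \tr (lin1_mx (fun v : 'rV[R]_n => curvature A D (extension A p v) Y Z p)).

Definition sym_ricci (R : realType) (n : nat) (M : topologicalType)
    (A : smooth_manifold R n M)
    (D : (M -> 'rV[R]_n) -> (M -> 'rV[R]_n) -> M -> 'rV[R]_n)
    (Y Z : M -> 'rV[R]_n) (p : M) : R :=
  2^-1 * (ricci A D Y Z p + ricci A D Z Y p).

Definition vanishing (R : realType) (n : nat) (M : topologicalType)
    (A : smooth_manifold R n M)
    (S : (M -> 'rV[R]_n) -> (M -> 'rV[R]_n) -> M -> R) : Prop :=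
  forall Y Z, vector_field A Y -> vector_field A Z -> forall p, S Y Z p = 0.

Definition einstein (R : realType) (n : nat) (M : topologicalType)
    (A : smooth_manifold R n M) (g : M -> 'M[R]_n)
    (D : (M -> 'rV[R]_n) -> (M -> 'rV[R]_n) -> M -> 'rV[R]_n) : Prop :=
  exists2 a : M -> R, smooth_function A a &
    forall X Y, vector_field A X -> vector_field A Y ->
    forall p, ricci A D X Y p = a p * inner g X Y p.

Definition killing (R : realType) (n : nat) (M : topologicalType)
    (A : smooth_manifold R n M) (g : M -> 'M[R]_n)
    (D : (M -> 'rV[R]_n) -> (M -> 'rV[R]_n) -> M -> 'rV[R]_n)
    (P : M -> 'rV[R]_n) : Prop :=
  forall X Y, vector_field A X -> vector_field A Y ->
  forall p, inner g (D X P) Y p + inner g (D Y P) X p = 0.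

Definition semi_quasi_einstein (R : realType) (n : nat) (M : topologicalType)
    (A : smooth_manifold R n M) (g : M -> 'M[R]_n)
    (D : (M -> 'rV[R]_n) -> (M -> 'rV[R]_n) -> M -> 'rV[R]_n) : Prop :=
  [/\ (3 <= n)%N,
      ~ vanishing A (sym_ricci A D) &
      exists (a b : M -> R) (eta : M -> 'cV[R]_n),
        [/\ smooth_function A a, smooth_function A b, one_form A eta,
            exists p, eta p != 0 &
            forall Y Z, vector_field A Y -> vector_field A Z ->
            forall p, sym_ricci A D Y Z p =
              a p * inner g Y Z p + b p * pairing eta Y p * pairing eta Z p]].

(* Main.v *)
(* Since Dbar_X Y = D_X Y + g(Y, P) X - g(X, Y) P, expanding the curvature and
   taking the trace over X gives, for P Killing (hence divergence-free),
     Sbar(Y, Z) = S(Y, Z)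
       - (n - 2) (g(D_Y P, Z) + |P|^2 g(Y, Z) - pi(Y) pi(Z)).
   The term g(D_Y P, Z) is skew and disappears by symmetrization, so S = a g
   gives
     Shat(Y, Z) = (a - (n - 2) |P|^2) g(Y, Z) + (n - 2) pi(Y) pi(Z).
   If Shat vanishes, its value at (w, w), with w nonzero orthogonal to P, then
   at (P, P), gives P = 0 and hence a = 0, which is excluded.
   The traces are taken over vector fields with prescribed values at a point,
   obtained by cutting off with a bump function built from exp(-1/t). *)

Require Import Defs.
From mathcomp Require Import all_boot all_order all_algebra.
From mathcomp Require Import all_classical all_reals all_analysis.
From mathcomp Require Import ring lra.

Set Implicit Arguments.
Unset Strict Implicit.
Unset Printing Implicit Defensive.

Import Order.TTheory GRing.Theory Num.Theory.
Import numFieldNormedType.Exports.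

Local Open Scope classical_set_scope.
Local Open Scope ring_scope.

(** * Smooth maps *)

Section smooth_on_theory.
Context {R : realType} {V : normedModType R}.
Implicit Types (W : normedModType R) (U : set V) (k : nat).

(** The differential of [f] also gives the first-order expansion of [g], since a little-o relation
    depends only on the germ; uniqueness of the expansion identifies the two differentials. *)
Lemma near_eq_differentiable W (f g : V -> W) (x : V) :
  (\near x, f x = g x) -> differentiable f x -> differentiable g x.
Proof.
move=> fg /diff_locallyP[dfc dfx].
have eqg : g \o shift x = cst (g x) + 'd f x +o_ (0 : V) id.
  apply/eqaddoP => e e0; move/eqaddoP : dfx => /(_ e e0).
  have fg0 : \forall y \near (0 : V), f (y + x) = g (y + x).
    by move: fg; rewrite (near_shift 0 x) /= subr0.
  apply: filterS2 fg0 => y /= fgy.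
  by rewrite !fctE /= fgy (nbhs_singleton fg).
by apply/diff_locallyP; rewrite (diff_unique dfc eqg).
Qed.

(** On an open [U], equality on [U] is equality of germs at each of its points, so the directional
    derivatives agree on [U] too and the induction closes. Formulas for derivatives valid only on
    [U] enter through this lemma. *)
Lemma kdiff_on_eq W k U (f g : V -> W) : open U ->
  (forall x, U x -> f x = g x) -> kdiff_on k U f -> kdiff_on k U g.
Proof.
move=> oU; elim: k f g => //= k IH f g fg [df Df].
have fg' x : U x -> \near x, f x = g x.
  by move=> Ux; apply: filterS fg _; exact: open_nbhs_nbhs.
split=> [x Ux|v]; first exact: near_eq_differentiable (fg' _ Ux) (df _ Ux).
by apply: IH (Df v) => x Ux; apply: near_eq_derive; exact: fg'.
Qed.

(** The definition is a condition at each point separately, so it may be checked on a set [U'] that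
    varies with the point. This serves to glue fields defined by cases. *)
Lemma kdiff_on_local W k U (f : V -> W) :
  (forall x, U x -> exists U', [/\ U' x & kdiff_on k U' f]) -> kdiff_on k U f.
Proof.
elim: k f => //= k IH f Uf; split=> [x /Uf[U' [U'x [df _]]]|v]; first exact: df.
by apply: IH => x /Uf[U' [U'x [_ Df]]]; exists U'; split.
Qed.

Lemma kdiff_on_cst W k U (w : W) : kdiff_on k U (cst w : V -> W).
Proof.
elim: k w => //= k IH w; split=> [x _|v]; first exact: differentiable_cst.
by rewrite (_ : 'D_v (cst w) = cst 0) //; apply/funext => x; rewrite derive_cst.
Qed.

Lemma kdiff_onD W k U (f g : V -> W) : open U ->
  kdiff_on k U f -> kdiff_on k U g -> kdiff_on k U (f + g).
Proof.
move=> oU; elim: k f g => //= k IH f g [df Df] [dg Dg].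
split=> [x Ux|v]; first by apply: differentiableD; [exact: df|exact: dg].
apply: kdiff_on_eq (IH _ _ (Df v) (Dg v)) => // x Ux.
by rewrite deriveD//; apply: diff_derivable; [exact: df|exact: dg].
Qed.

Lemma kdiff_onW W k U (f : V -> W) : kdiff_on k.+1 U f -> kdiff_on k U f.
Proof.
elim: k f => //= k IH f [df Df]; split=> // v; exact: IH (Df v).
Qed.

Lemma kdiff_onM k U (f g : V -> R) : open U ->
  kdiff_on k U f -> kdiff_on k U g -> kdiff_on k U (f * g).
Proof.
move=> oU; elim: k f g => //= k IH f g [df Df] [dg Dg].
split=> [x Ux|v]; first by apply: differentiableM; [exact: df|exact: dg].
(* The Leibniz rule leaves [f] and [g] undifferentiated, so they are needed at order [k] as well. *)
have kf : kdiff_on k U f by apply: kdiff_onW; split.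
have kg : kdiff_on k U g by apply: kdiff_onW; split.
apply: (@kdiff_on_eq _ _ _ (f * 'D_v g + g * 'D_v f)) => // [x Ux|].
  by rewrite deriveM//; apply: diff_derivable; [exact: df|exact: dg].
by apply: kdiff_onD => //; apply: IH.
Qed.

Lemma differentiable_mxP m n (f : V -> 'M[R]_(m, n)) (x : V) :
  differentiable f x <-> forall i j, differentiable (fun y => f y i j) x.
Proof.
split=> [df i j|df].
  exact: (@differentiable_comp _ _ _ _ f (fun N : 'M[R]_(m, n) => N i j) x
    df (differentiable_coord _ _ _)).
rewrite (_ : f = \sum_i \sum_j (fun y => f y i j *: delta_mx i j)); last first.
  apply/funext => y; rewrite fct_sumE [LHS]matrix_sum_delta.
  by apply: eq_bigr => i _; rewrite fct_sumE.
apply: differentiable_sum => i; apply: differentiable_sum => j.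
exact: differentiableZl.
Qed.

Lemma kdiff_on_mxP m n k U (f : V -> 'M[R]_(m, n)) : open U ->
  kdiff_on k U f <-> forall i j, kdiff_on k U (fun x => f x i j).
Proof.
move=> oU.
have Dij (f' : V -> 'M[R]_(m, n)) x v i j : U x ->
    differentiable f' x -> 'D_v f' x i j = 'D_v (fun y => f' y i j) x.
  by move=> Ux df; rewrite derive_mx ?mxE//; exact: diff_derivable.
elim: k f => //= k IH f; split=> [[df Df] i j|kf].
  split=> [x Ux|v]; first by move: i j; apply/differentiable_mxP; exact: df.
  move/IH : (Df v) => /(_ i j); apply: kdiff_on_eq => // x Ux.
  by apply: Dij => //; exact: df.
have df x : U x -> differentiable f x.
  by move=> Ux; apply/differentiable_mxP => i j; apply: (kf i j).1.
split=> // v; apply/IH => i j.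
by apply: kdiff_on_eq ((kf i j).2 v) => // x Ux; rewrite Dij//; exact: df.
Qed.

End smooth_on_theory.

Section smooth_on_matrix.
Context {R : realType} {V : normedModType R}.
Implicit Types (U : set V) (k : nat).

Lemma smooth_on_mxP m n U (f : V -> 'M[R]_(m, n)) : open U ->
  smooth_on U f <-> forall i j, smooth_on U (fun x => f x i j).
Proof.
move=> oU; split=> [sf i j k|sf k].
  by move: (i) (j); apply/kdiff_on_mxP.
by apply/kdiff_on_mxP => // i j; exact: sf.
Qed.

Lemma kdiff_on_sum (W : normedModType R) (I : Type) (r : seq I) k U
    (f : I -> V -> W) : open U ->
  (forall i, kdiff_on k U (f i)) -> kdiff_on k U (fun x => \sum_(i <- r) f i x).
Proof.
move=> oU kf; rewrite (_ : (fun x => _) = \sum_(i <- r) f i).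
  elim/big_ind : _ => //; [exact: kdiff_on_cst|by move=> ? ?; exact: kdiff_onD].
by apply/funext => x; rewrite fct_sumE.
Qed.

Lemma kdiff_on_mulmx m n p k U (f : V -> 'M[R]_(m, n)) (h : V -> 'M[R]_(n, p)) :
  open U -> kdiff_on k U f -> kdiff_on k U h ->
  kdiff_on k U (fun x => f x *m h x).
Proof.
move=> oU /(kdiff_on_mxP _ _ oU) kf /(kdiff_on_mxP _ _ oU) kh.
apply/kdiff_on_mxP => // i j.
rewrite (_ : (fun x => _) = fun x => \sum_l (f x i l * h x l j)).
  by apply: kdiff_on_sum => // l; exact: (kdiff_onM oU (kf i l) (kh l j)).
by apply/funext => x; rewrite mxE.
Qed.

Lemma smooth_on_mulmx m n p U (f : V -> 'M[R]_(m, n)) (h : V -> 'M[R]_(n, p)) :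
  open U -> smooth_on U f -> smooth_on U h ->
  smooth_on U (fun x => f x *m h x).
Proof. by move=> oU sf sh k; apply: kdiff_on_mulmx. Qed.

Lemma smooth_on_trmx m n U (f : V -> 'M[R]_(m, n)) :
  open U -> smooth_on U f -> smooth_on U (fun x => (f x)^T).
Proof.
move=> oU /(smooth_on_mxP _ oU) sf; apply/smooth_on_mxP => // i j.
rewrite (_ : (fun x => _) = fun x => f x j i)//.
by apply/funext => x; rewrite mxE.
Qed.

Lemma smooth_on_scale m n U (f : V -> R) (h : V -> 'M[R]_(m, n)) :
  open U -> smooth_on U f -> smooth_on U h ->
  smooth_on U (fun x => f x *: h x).
Proof.
move=> oU sf /(smooth_on_mxP _ oU) sh; apply/smooth_on_mxP => // i j k.
rewrite (_ : (fun x => _) = f * (fun x => h x i j)).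
  exact: (kdiff_onM oU (sf k) (sh i j k)).
by apply/funext => x; rewrite mxE.
Qed.

End smooth_on_matrix.

Section smooth_on_comp.
Context {R : realType} {V : normedModType R}.

(** The chain rule is written as a sum over i of (D_v h)_i times (D_{e_i} f) o h. The directions e_i
    are fixed, so the induction hypothesis applies to each derivative of [f]. *)
Lemma kdiff_on_comp m k (U : set V) (U' : set 'rV[R]_m) (h : V -> 'rV[R]_m)
    (f : 'rV[R]_m -> R) : open U -> (forall x, U x -> U' (h x)) ->
  kdiff_on k U h -> kdiff_on k U' f -> kdiff_on k U (f \o h).
Proof.
move=> oU hU; elim: k f => //= k IH f [dh Dh] [df Df].
split=> [x Ux|v].
  by apply: differentiable_comp; [exact: dh|exact/df/hU].
apply: (@kdiff_on_eq _ _ _ _ _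
    (fun x => \sum_i ('D_v h x 0 i * ('D_(delta_mx 0 i) f \o h) x))) => //.
  move=> x Ux; have [dhx dfx] := (dh _ Ux, df _ (hU _ Ux)).
  rewrite [RHS]deriveE; last exact: differentiable_comp.
  rewrite diff_comp//= -(deriveE v dhx).
  rewrite [in RHS](row_sum_delta ('D_v h x)) linear_sum/=.
  apply: eq_bigr => i _; rewrite linearZ/= (deriveE _ dfx); exact: erefl.
have kh : kdiff_on k U h by apply: kdiff_onW; split.
apply: (kdiff_on_sum _ (f := fun i x =>
    'D_v h x 0 i * 'D_(delta_mx 0 i) f (h x))) => // i.
apply: (kdiff_onM (f := fun x => 'D_v h x 0 i)
    (g := 'D_(delta_mx 0 i) f \o h) oU); last exact: IH.
by have /(kdiff_on_mxP _ _ oU) := Dh v; exact.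
Qed.

Lemma smooth_on_comp m (U : set V) (U' : set 'rV[R]_m) (h : V -> 'rV[R]_m)
    (f : 'rV[R]_m -> R) : open U -> (forall x, U x -> U' (h x)) ->
  smooth_on U h -> smooth_on U' f -> smooth_on U (f \o h).
Proof. by move=> oU hU sh sf k; apply: kdiff_on_comp (sh k) (sf k). Qed.

Lemma smooth_on_comp_mx m p q (U : set V) (U' : set 'rV[R]_m)
    (h : V -> 'rV[R]_m) (f : 'rV[R]_m -> 'M[R]_(p, q)) :
  open U -> open U' -> (forall x, U x -> U' (h x)) ->
  smooth_on U h -> smooth_on U' f -> smooth_on U (f \o h).
Proof.
move=> oU oU' hU sh /(smooth_on_mxP _ oU') sf; apply/smooth_on_mxP => // i j.
exact: (smooth_on_comp oU hU sh (sf i j)).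
Qed.

(** Entry (i, j) is the j-th coordinate of the derivative along e_i, so order k of the Jacobian
    comes from order k+1 of [f]. *)
Lemma smooth_on_jacobian m p (U : set 'rV[R]_m) (f : 'rV[R]_m -> 'rV[R]_p) :
  open U -> smooth_on U f -> smooth_on U (jacobian f).
Proof.
move=> oU sf; apply/smooth_on_mxP => // i j k.
have [df /(_ (delta_mx 0 i)) /(kdiff_on_mxP _ _ oU) /(_ 0 j)] := sf k.+1.
apply: kdiff_on_eq => // x Ux.
by rewrite deriveE ?mxE//; exact: df.
Qed.

End smooth_on_comp.

(** * Bump functions *)

Section flat_exponential.
Context {R : realType}.

(* The functions t^-m exp(-1/t), flat at 0, are closed under differentiation
   up to linear combinations. *)
Definition flat_exp (m : nat) (t : R) : R :=
  if 0 < t then t^-1 ^+ m * expR (- t^-1) else 0.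

Lemma flat_exp_ge0 m t : 0 <= flat_exp m t.
Proof.
rewrite /flat_exp; case: ifP => // t0.
by rewrite mulr_ge0 ?expR_ge0// exprn_ge0// invr_ge0 ltW.
Qed.

(** With s = 1/t this is exp(s) >= s^(m+2) / (m+2)!. The quadratic bound makes the function
    differentiable at 0 with derivative 0. *)
Lemma flat_exp_le m t : flat_exp m t <= (m.+2)`!%:R * t ^+ 2.
Proof.
rewrite /flat_exp; case: ifPn => [t0|_]; last by rewrite mulr_ge0 ?sqr_ge0.
have s0 : 0 < t^-1 by rewrite invr_gt0.
have f0 : 0 < (m.+2)`!%:R :> R by rewrite ltr0n fact_gt0.
rewrite expRN ler_pdivrMr ?expR_gt0//.
have -> : t^-1 ^+ m = (m.+2)`!%:R * t ^+ 2 * (t^-1 ^+ m.+2 / (m.+2)`!%:R).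
  rewrite -addn2 exprD exprVn.
  by field; rewrite addn2 expf_neq0 !gt_eqF.
rewrite ler_pM2l ?mulr_gt0 ?exprn_gt0//.
by apply: le_trans (expR_ge1Dxn m.+1 (ltW s0)); rewrite lerDr.
Qed.

Lemma is_derive_flat_exp m (t : R) :
  is_derive t 1 (flat_exp m) (flat_exp m.+2 t - m%:R * flat_exp m.+1 t).
Proof.
have [t0|t0|->] := ltgtP t 0.
- rewrite /flat_exp ltNge (ltW t0)/= mulr0 subr0.
  apply: (@near_eq_is_derive _ _ _ (cst 0)).
  near=> s; rewrite /flat_exp ltNge ifF//; apply/negbF/ltW.
  by near: s; exact: lt_nbhsl.
- have dV : is_derive t 1 (fun s : R => s^-1) (- t ^- 2).
    apply: is_derive_eq (is_deriveV (lt0r_neq0 t0) (is_derive_id t (1 : R))) _.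
    exact: mulr1.
  have dE : is_derive t 1 (fun s : R => expR (- s^-1)) (expR (- t^-1) * t ^- 2).
    apply: (is_derive_eq (is_derive1_comp (is_derive_expR _) (is_deriveN dV))).
    by rewrite opprK.
  have dX : is_derive t 1 (fun s : R => s^-1 ^+ m)
      (m%:R * t^-1 ^+ m.-1 * - t ^- 2).
    rewrite (_ : (fun s : R => _) = (fun s : R => s^-1) ^+ m); last first.
      by apply/funext => s; rewrite fctE.
    exact: (is_derive_eq (is_deriveX m dV)).
  have dM := is_deriveM dX dE.
  have fE : \near t, ((fun s : R => s^-1 ^+ m) *
      (fun s : R => expR (- s^-1))) t = flat_exp m t.
    near=> s; rewrite /flat_exp ifT//.
    by near: s; exact: lt_nbhsr.
  have := near_eq_is_derive fE dM.
  move/is_derive_eq; apply.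
  transitivity (t^-1 ^+ m * (expR (- t^-1) / t ^+ 2) +
    expR (- t^-1) * (m%:R * t^-1 ^+ m.-1 * - t ^- 2)) => //.
  rewrite /flat_exp t0 -exprVn; set s := t^-1.
  (* The truncated exponent [m.-1] requires m = 0 apart; there the factor [m%:R] is 0. *)
  case: m {dX dM fE} => [|m] /=; rewrite ?exprS; ring.
(* At 0 the difference quotient is at most (m+2)! |h| in absolute value, hence tends to 0, the value
   of the formula there. *)
- have f0 j : flat_exp j 0 = 0 by rewrite /flat_exp ltxx.
  rewrite !f0 mulr0 subr0.
  suff df : h^-1 *: (flat_exp m (h *: 1 + 0) - flat_exp m 0) @[h --> 0^'] --> 0.
    by apply: DeriveDef; [apply/cvg_ex; exists 0|exact: cvg_lim df].
  apply/cvgr0Pnorm_lt => e e0; near=> h.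
  rewrite f0 subr0 addr0 [h *: 1]mulr1 normrZ normfV.
  rewrite (ger0_norm (flat_exp_ge0 m h)).
  rewrite mulrC ltr_pdivrMr ?normr_gt0; last by near: h; exact: nbhs_dnbhs_neq.
  apply: le_lt_trans (flat_exp_le m h) _.
  rewrite -real_normK ?num_real// expr2 mulrA ltr_pM2r; last first.
    by rewrite normr_gt0; near: h; exact: nbhs_dnbhs_neq.
  rewrite mulrC -ltr_pdivlMr ?ltr0n ?fact_gt0//.
  near: h; apply: dnbhs0_lt; rewrite divr_gt0// ltr0n fact_gt0//.
Unshelve. all: by end_near. Qed.

End flat_exponential.

Section bump.
Context {R : realType}.

(** A derivative of the composite is D_v u times a combination of [flat_exp] with indices m+2 and
    m+1, so the induction on [k] runs over all [m] at once. *)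
Lemma kdiff_on_flat_exp {V : normedModType R} m k (U : set V) (u : V -> R) :
  open U -> kdiff_on k U u -> kdiff_on k U (flat_exp m \o u).
Proof.
move=> oU; elim: k m u => //= k IH m u [du Du].
have dexp j s : differentiable (flat_exp j : R -> R) s.
  by apply/derivable1_diffP; have [] := is_derive_flat_exp j s.
split=> [x Ux|v]; first by apply: differentiable_comp; [exact: du|exact: dexp].
pose df := (flat_exp m.+2 \o u) + cst (- m%:R) * (flat_exp m.+1 \o u).
apply: (@kdiff_on_eq _ _ _ _ _ ('D_v u * df)) => // [x Ux|].
  rewrite [RHS]deriveE; last first.
    by apply: differentiable_comp; [exact: du|exact: dexp].
  rewrite diff_comp/=; [|exact: du|exact: dexp].
  rewrite -(deriveE v (du x Ux)) diff1E; last exact: dexp.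
  rewrite derive1E; have [_ ->] := is_derive_flat_exp m (u x).
  by rewrite /df /= !fctE /= mulNr.
have ku : kdiff_on k U u by apply: kdiff_onW; split.
apply: kdiff_onM => //; apply: kdiff_onD => //; first exact: IH.
by apply: kdiff_onM => //; [exact: kdiff_on_cst|exact: IH].
Qed.

Lemma smooth_on_id {V : normedModType R} (U : set V) : smooth_on U (@id V).
Proof.
case=> //= k; split=> // v; have -> : 'D_v (@id V) = cst v.
  by apply/funext => x; rewrite derive_id.
exact: kdiff_on_cst.
Qed.

(** The function [u] uses the Euclidean square, a polynomial, whereas the norm is the maximum of the
    coordinates. If that maximum is at least [r], one coordinate already makes the sum of squares at
    least r^2. *)
Lemma smooth_bump n (x0 : 'rV[R]_n) (r : R) : 0 < r ->
  exists psi : 'rV[R]_n -> R, [/\ smooth_on setT psi, psi x0 = 1 &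
    forall x, r <= `|x - x0| -> psi x = 0].
Proof.
move=> r0; pose u (x : 'rV[R]_n) := r ^+ 2 - \sum_i (x 0 i - x0 0 i) ^+ 2.
have s0 : flat_exp 0 (r ^+ 2) != 0.
  by rewrite /flat_exp exprn_gt0// expr0 mul1r expR_eq0.
exists (fun x => (flat_exp 0 (r ^+ 2))^-1 * flat_exp 0 (u x)); split.
- move=> k; apply: (@kdiff_onM _ _ _ _ (cst _)); [exact: openT| |].
    exact: kdiff_on_cst.
  apply: kdiff_on_flat_exp; first exact: openT.
  rewrite (_ : u = cst (r ^+ 2) + (fun x => \sum_i (- (x 0 i - x0 0 i) ^+ 2))).
    apply: kdiff_onD; [exact: openT|exact: kdiff_on_cst|].
    apply: kdiff_on_sum => [|i]; first exact: openT.
    pose l := fun x : 'rV[R]_n => x 0 i.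
    rewrite (_ : (fun x => _) =
        cst (- 1) * ((l + cst (- x0 0 i)) * (l + cst (- x0 0 i)))).
      have kl : kdiff_on k setT (l + cst (- x0 0 i)).
        apply: kdiff_onD; [exact: openT| |exact: kdiff_on_cst].
        exact: ((kdiff_on_mxP _ _ openT).1 (smooth_on_id _ k)).
      apply: kdiff_onM; [exact: openT|exact: kdiff_on_cst|].
      by apply: kdiff_onM; [exact: openT| |].
    by apply/funext => x; rewrite !fctE mulN1r expr2.
  by apply/funext => x; rewrite fctE /u -sumrN.
- rewrite /u big1 ?subr0 ?mulVf// => i _.
  by rewrite subrr expr0n.
- move=> x rx; rewrite [flat_exp 0 (u x)]ifN ?mulr0// -leNgt subr_le0.
  have : `|x - x0| != 0 by rewrite gt_eqF// (lt_le_trans r0).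
  move=> /mx_norm_neq0[[i j] /= xij].
  rewrite (bigD1 j)//= -[leLHS]addr0 lerD ?sumr_ge0// => [|l _].
    rewrite -[leRHS]real_normK ?num_real// lerXn2r ?nnegrE ?(ltW r0)//.
    move: rx; rewrite {1}/Num.Def.normr /= xij !mxE.
    by rewrite (ord1 i).
  exact: sqr_ge0.
Qed.

End bump.

(** * Changes of charts *)

Section jacobian_theory.
Context {R : realType}.

Lemma near_eq_jacobian m n (f h : 'rV[R]_m -> 'rV[R]_n) x :
  (\near x, f x = h x) -> differentiable f x -> 'J f x = 'J h x.
Proof.
move=> fh df; have dh := near_eq_differentiable fh df.
have [f' h'] := (fun v => deriveE v df, fun v => deriveE v dh).
apply/row_matrixP => i; rewrite [LHS]rowE [RHS]rowE.
rewrite [LHS]mul_rV_lin1 [RHS]mul_rV_lin1 -[LHS]f' -[RHS]h'.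
exact: near_eq_derive.
Qed.

Lemma jacobian_id n (x : 'rV[R]_n) : 'J id x = 1%:M.
Proof.
have [did _] := is_diff_id x; have id' v := deriveE v did.
apply/row_matrixP => i; rewrite [LHS]rowE row1 [LHS]mul_rV_lin1 -[LHS]id'.
exact: derive_id.
Qed.

(** Tangent vectors are rows multiplied on the right, so the factors stand in the order in which the
    maps are applied. *)
Lemma jacobian_comp m n p (f : 'rV[R]_m -> 'rV[R]_n)
    (h : 'rV[R]_n -> 'rV[R]_p) x :
  differentiable f x -> differentiable h (f x) ->
  'J (h \o f) x = 'J f x *m 'J h (f x).
Proof.
move=> df dh; apply/row_matrixP => i; rewrite [LHS]rowE [RHS]rowE mulmxA.
rewrite [LHS]mul_rV_lin1 [RHS]mul_rV_lin1 [in RHS]mul_rV_lin1.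
by rewrite diff_comp.
Qed.

End jacobian_theory.

Section charts.
Context {R : realType} {n : nat} {M : topologicalType}.
Implicit Types (c : chart R n M) (p : M).

Lemma chart_image_open c (O : set M) :
  open O -> open (cmap c @` (cdom c `&` O)).
Proof.
move=> oO.
rewrite (_ : _ @` _ = cmap c @` cdom c `&` cinv c @^-1` O); last first.
  apply/seteqP; split=> [_ [p [cp Op] <-]|_ [[p cp <-]]].
    by split; [exists p|rewrite /= cmapK].
  by rewrite /= cmapK// => Op; exists p.
rewrite openE => x [cx Ox]; apply: filterI.
  by apply: open_nbhs_nbhs; split=> //; exact: cimg_open.
by apply: (cinv_continuous cx); apply: open_nbhs_nbhs.
Qed.

Lemma cinv_dom c x : (cmap c @` cdom c) x -> cdom c (cinv c x).
Proof. by move=> [p cp <-]; rewrite cmapK. Qed.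

Lemma cinv_near c p (O : set M) : cdom c p -> open O -> O p ->
  \forall x \near cmap c p, (cmap c @` (cdom c `&` O)) x.
Proof.
move=> cp oO Op; apply: open_nbhs_nbhs; split; last by exists p.
exact: chart_image_open.
Qed.

Variable A : smooth_manifold R n M.

Lemma transition_differentiable c c' p : atlas A c -> atlas A c' ->
  cdom c p -> cdom c' p -> differentiable (cmap c' \o cinv c) (cmap c p).
Proof.
move=> Ac Ac' cp c'p; have [df _] := atlas_smooth Ac Ac' 1.
by apply: df; exists p.
Qed.

Lemma change_refl c p : atlas A c -> cdom c p -> change c c p = 1%:M.
Proof.
move=> Ac cp; rewrite /change -(jacobian_id (cmap c p)).
apply: near_eq_jacobian; last exact: transition_differentiable.
have := cinv_near cp openT I; apply: filterS => x [q [cq _] <-] /=.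
by rewrite cmapK.
Qed.

(** Cocycle rule: near [cmap c p] the transition from [c] to [c''] is the composite through [c'],
    and the chain rule applies. *)
Lemma change_trans c c' c'' p : atlas A c -> atlas A c' -> atlas A c'' ->
  cdom c p -> cdom c' p -> cdom c'' p ->
  change c c' p *m change c' c'' p = change c c'' p.
Proof.
move=> Ac Ac' Ac'' cp c'p c''p; rewrite /change.
have d1 := transition_differentiable Ac Ac' cp c'p.
have d2 := transition_differentiable Ac' Ac'' c'p c''p.
have e : (cmap c' \o cinv c) (cmap c p) = cmap c' p by rewrite /= cmapK.
rewrite -e in d2; have := jacobian_comp d1 d2; rewrite e => <-.
apply: near_eq_jacobian; last exact: differentiable_comp.
have := cinv_near cp (cdom_open c') c'p; apply: filterS => _ [q [cq c'q] <-] /=.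
by rewrite !cmapK.
Qed.

Lemma changeK c c' p : atlas A c -> atlas A c' -> cdom c p -> cdom c' p ->
  change c c' p *m change c' c p = 1%:M.
Proof.
by move=> Ac Ac' cp c'p; rewrite (change_trans Ac Ac' Ac)// change_refl.
Qed.

(** In the coordinates of [c'], this is the Jacobian of the transition from [c] to [c'] evaluated
    along the transition from [c'] to [c]. *)
Lemma smooth_change c c' : atlas A c -> atlas A c' ->
  smooth_on (cmap c' @` (cdom c' `&` cdom c)) (change c c' \o cinv c').
Proof.
move=> Ac Ac'.
apply: (@smooth_on_comp_mx _ _ _ _ _ _ (cmap c @` (cdom c `&` cdom c'))
  (cmap c \o cinv c') (jacobian (cmap c' \o cinv c))).
- exact/chart_image_open/cdom_open.
- exact/chart_image_open/cdom_open.
- by move=> _ [p [c'p cp] <-] /=; rewrite cmapK//; exists p.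
- exact: (atlas_smooth Ac' Ac).
- apply: smooth_on_jacobian; first exact/chart_image_open/cdom_open.
  exact: (atlas_smooth Ac Ac').
Qed.

End charts.

(** * Tensor fields *)

Section fields.
Context {R : realType} {n : nat} {M : topologicalType}.
Variable A : smooth_manifold R n M.
Implicit Types (c : chart R n M) (p : M) (X Y : M -> 'rV[R]_n).

Lemma smooth_on_chart_eq (W : normedModType R) c (T T' : M -> W) :
  (forall p, cdom c p -> T p = T' p) ->
  smooth_on (cmap c @` cdom c) (T \o cinv c) ->
  smooth_on (cmap c @` cdom c) (T' \o cinv c).
Proof.
move=> TT' sT k; apply: kdiff_on_eq (sT k); first exact: cimg_open.
by move=> x /cinv_dom /TT'.
Qed.

Lemma smooth_function_cst (a : R) : smooth_function A (fun=> a).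
Proof. move=> c Ac k; exact: kdiff_on_cst. Qed.

Lemma smooth_functionD f h : smooth_function A f -> smooth_function A h ->
  smooth_function A (fun p => f p + h p).
Proof.
move=> sf sh c Ac k.
exact: (kdiff_onD (f := f \o cinv c) (g := h \o cinv c)
  (@cimg_open _ _ _ c) (sf c Ac k) (sh c Ac k)).
Qed.

Lemma smooth_functionM f h : smooth_function A f -> smooth_function A h ->
  smooth_function A (fun p => f p * h p).
Proof.
move=> sf sh c Ac k.
exact: (kdiff_onM (f := f \o cinv c) (g := h \o cinv c)
  (@cimg_open _ _ _ c) (sf c Ac k) (sh c Ac k)).
Qed.

Lemma vector_fieldD X Y : vector_field A X -> vector_field A Y ->
  vector_field A (fun p => X p + Y p).
Proof.
move=> sX sY c Ac; apply: (@smooth_on_chart_eq _ _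
    (vector_in A X c + vector_in A Y c)) => [p _|k].
  by rewrite fctE /vector_in mulmxDl.
exact: (kdiff_onD (f := vector_in A X c \o cinv c)
  (g := vector_in A Y c \o cinv c)
  (@cimg_open _ _ _ c) (sX c Ac k) (sY c Ac k)).
Qed.

Lemma vector_fieldZ f X : smooth_function A f -> vector_field A X ->
  vector_field A (fun p => f p *: X p).
Proof.
move=> sf sX c Ac; apply: (@smooth_on_chart_eq _ _
    (fun p => f p *: vector_in A X c p)) => [p _|].
  by rewrite /vector_in scalemxAl.
exact: smooth_on_scale (@cimg_open _ _ _ c) (sf c Ac) (sX c Ac).
Qed.

Lemma changeK_at c p : atlas A c -> cdom c p ->
  change (chart_at A p) c p *m change c (chart_at A p) p = 1%:M.
Proof.
move=> Ac cp; apply: (changeK (A := A)) => //.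
  exact: chart_at_atlas.
exact: chart_at_dom.
Qed.

Variables (g : M -> 'M[R]_n) (metric_g : riemannian_metric A g).

(** Lowering the index is done in a fixed chart, where the matrix of [g] and the column of [X] are
    smooth and the Jacobians between them cancel. *)
Lemma one_form_flat X :
  vector_field A X -> one_form A (fun p => g p *m (X p)^T).
Proof.
move=> sX c Ac; apply: (@smooth_on_chart_eq _ _
    (fun p => bilinear_in A g c p *m (vector_in A X c p)^T)) => [p cp|].
  rewrite /bilinear_in /vector_in /covector_in trmx_mul -!mulmxA.
  do 2 congr (_ *m _).
  by rewrite mulmxA -trmx_mul changeK_at// trmx1 mul1mx.
apply: (smooth_on_mulmx (@cimg_open _ _ _ c) (metric_smooth metric_g Ac)).
exact: smooth_on_trmx (@cimg_open _ _ _ c) (sX c Ac).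
Qed.

(** The raw coordinates at [p] refer to [chart_at A p], which may jump with [p]. The value is
    therefore recomputed in a fixed chart, the two Jacobians being inverse to each other. *)
Lemma smooth_pairing (w : M -> 'cV[R]_n) X : one_form A w -> vector_field A X ->
  smooth_function A (pairing w X).
Proof.
move=> sw sX c Ac; apply: (@smooth_on_chart_eq _ _
    (fun p => (vector_in A X c p *m covector_in A w c p) 0 0)) => [p cp|].
  by rewrite /vector_in /covector_in mulmxA -(mulmxA (X p)) changeK_at// mulmx1.
apply: ((smooth_on_mxP _ (@cimg_open _ _ _ c)).1 _ 0 0).
exact: smooth_on_mulmx (@cimg_open _ _ _ c) (sX c Ac) (sw c Ac).
Qed.

Lemma smooth_inner X Y : vector_field A X -> vector_field A Y ->
  smooth_function A (inner g X Y).
Proof.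
move=> sX sY; have := smooth_pairing (one_form_flat sY) sX.
by rewrite (_ : pairing _ _ = inner g X Y)//; apply/funext => p;
  rewrite /pairing /inner mulmxA.
Qed.

End fields.

(** * Vector fields with a prescribed value at a point *)

Section extension_existence.
Context {R : realType} {n : nat} {M : topologicalType}.
Variable A : smooth_manifold R n M.

Lemma vector_field_extension (p : M) (v : 'rV[R]_n) :
  exists2 X, vector_field A X & X p = v.
Proof.
pose c := chart_at A p; have Ac : atlas A c by exact: chart_at_atlas.
have cp : cdom c p by exact: chart_at_dom.
set x0 := cmap c p.
have /nbhs_ballP[e /= e0 ballc] : nbhs x0 (cmap c @` cdom c).
  by apply: open_nbhs_nbhs; split; [exact: cimg_open|exists p].
(* Halving the radius keeps the closed ball inside the chart image; [psi] is chosen to vanish off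
   it. *)
pose B := closed_ball_ Num.norm x0 (e / 2).
have Bc : B `<=` cmap c @` cdom c.
  move=> x /= Bx; apply: ballc; rewrite -ball_normE /=.
  by apply: le_lt_trans Bx _; rewrite ltr_pdivrMr// ltr_pMr// ltr1n.
have [psi [psi_smooth psi1 psi0]] := smooth_bump x0 (divr_gt0 e0 (ltr0n R 2)).
(* The support of psi, carried to M, is compact, hence closed as M is Hausdorff:
   extending by 0 outside of the chart is smooth. *)
have Kcl : closed (cinv c @` B).
  apply: compact_closed; first exact: manifold_hausdorff A.
  apply: continuous_compact.
    by apply: continuous_in_subspaceT => x /set_mem /Bc; exact: cinv_continuous.
  apply: bounded_closed_compact; last exact: closed_closed_ball_.
  exists (`|x0| + e / 2); split; first exact: num_real.
  move=> r xr x Bx /=; apply: le_trans (ltW xr).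
  by rewrite -(subKr x0 x) (le_trans (ler_normB _ _))// lerD2l.
(* The constant coordinates [v] in [c] are converted to those of [chart_at A q], in which a value at
   [q] is expressed. *)
pose X q := if `[< cdom c q >] then
  psi (cmap c q) *: (v *m change c (chart_at A q) q) else 0.
exists X; last first.
  by rewrite /X asboolT// psi1 scale1r (change_refl Ac)// mulmx1.
move=> c' Ac' k; apply: kdiff_on_local => _ [q c'q <-].
have [cq|ncq] := pselect (cdom c q).
(* On the overlap, the cocycle rule turns the expression in [c'] into [psi] times [v] times the
   Jacobian from [c] to [c']. *)
- exists (cmap c' @` (cdom c' `&` cdom c)); split; first by exists q.
  have oU : open (cmap c' @` (cdom c' `&` cdom c)).
    exact/chart_image_open/cdom_open.
  apply: (@kdiff_on_eq _ _ _ _ _ (fun y => (psi \o (cmap c \o cinv c')) y *: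
     (v *m (change c c' \o cinv c') y))) => //.
    move=> _ [q' [c'q' cq'] <-] /=; rewrite /vector_in cmapK// /X asboolT//.
    rewrite -scalemxAl -mulmxA (change_trans Ac _ Ac')//.
      exact: chart_at_atlas.
    exact: chart_at_dom.
  move: k; apply: smooth_on_scale => //.
    apply: (smooth_on_comp oU _ _ psi_smooth) => //.
    exact: (atlas_smooth Ac' Ac).
  apply: smooth_on_mulmx => //; last exact: (smooth_change Ac Ac').
  by move=> k; exact: kdiff_on_cst.
(* Outside the chart, [q] lies in the open complement of the image of [B], where the field is
   identically 0. *)
- exists (cmap c' @` (cdom c' `&` ~` (cinv c @` B))); split.
    exists q => //; split=> // -[x /Bc /cinv_dom cx] xq.
    by apply: ncq; rewrite -xq.
  apply: (@kdiff_on_eq _ _ _ _ _ (cst 0)); last exact: kdiff_on_cst.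
    by apply: chart_image_open; rewrite openC.
  move=> _ [q' [c'q' Kq'] <-] /=; rewrite cmapK// /vector_in /X.
  case: asboolP => cq'; last by rewrite mul0mx.
  rewrite psi0 ?scale0r ?mul0mx// leNgt; apply/negP => qB.
  apply: Kq'; exists (cmap c q'); last by rewrite cmapK.
  by rewrite /B /closed_ball_ /= distrC ltW.
Qed.

Lemma extensionP p v :
  vector_field A (extension A p v) /\ extension A p v p = v.
Proof.
have [X sX Xp] := vector_field_extension p v.
by rewrite /extension; case: xgetP => [Y _ //|/(_ X)[]].
Qed.

End extension_existence.

(** * The curvature of the semi-symmetric connection *)

Section bilinear_form.
Context {R : realType} {n : nat} (B : 'M[R]_n).
Implicit Types u v w : 'rV[R]_n.

(** The value of [inner] at one point, stated on vectors instead of fields so that bilinearity can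
    be used pointwise. *)
Definition form u v : R := (u *m B *m v^T) 0 0.

Lemma formDl u v w : form (u + v) w = form u w + form v w.
Proof. by rewrite /form !mulmxDl mxE. Qed.

Lemma formZl a u w : form (a *: u) w = a * form u w.
Proof. by rewrite /form -!scalemxAl mxE. Qed.

Lemma formNl u w : form (- u) w = - form u w.
Proof. by rewrite -scaleN1r formZl mulN1r. Qed.

Lemma formDr u v w : form w (u + v) = form w u + form w v.
Proof. by rewrite /form linearD/= mulmxDr mxE. Qed.

Lemma formZr a u w : form w (a *: u) = a * form w u.
Proof. by rewrite /form linearZ/= -scalemxAr mxE. Qed.

Lemma formNr u w : form w (- u) = - form w u.
Proof. by rewrite -scaleN1r formZr mulN1r. Qed.

(** This is the trace of the rank-one endomorphism sending v to B(v, w) u. *)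
Lemma sum_form_delta u w : \sum_i form 'e_i w * u 0 i = form u w.
Proof.
rewrite {2}[u]row_sum_delta /form !mulmx_suml summxE.
by apply: eq_bigr => i _; rewrite -!scalemxAl [RHS]mxE mulrC.
Qed.

Hypothesis B_sym : B^T = B.

Lemma formC u v : form u v = form v u.
Proof.
rewrite /form; transitivity ((u *m B *m v^T)^T 0 0); first by rewrite [RHS]mxE.
by rewrite !trmx_mul trmxK B_sym mulmxA.
Qed.

Hypothesis B_pos : forall v, v != 0 -> 0 < form v v.

Lemma form_unitmx : B \in unitmx.
Proof.
rewrite -row_free_unit; apply: inj_row_free => v vB0; apply/eqP/negPn/negP.
by move/B_pos; rewrite /form vB0 mul0mx mxE ltxx.
Qed.

(** Meant for [L i] the covariant derivative of [P] along e_i: a Killing field is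
    divergence-free. *)
Lemma trace_skew (L : 'I_n -> 'rV[R]_n) :
  (forall i j, form (L i) 'e_j + form (L j) 'e_i = 0) -> \sum_i L i 0 i = 0.
Proof.
move=> skL; pose N := \matrix_i L i.
have NBE i j : (N *m B) i j = form (L i) 'e_j.
  by rewrite /form -(rowK L i) -row_mul trmx_delta -colE [RHS]mxE [RHS]mxE.
have skN : (N *m B)^T = - (N *m B).
  apply/matrixP => i j; rewrite [LHS]mxE [RHS]mxE !NBE.
  by apply/eqP; rewrite -addr_eq0 skL.
have -> : \sum_i L i 0 i = \tr N by apply: eq_bigr => i _; rewrite mxE.
(* N is the product of the skew matrix N B and the symmetric matrix B^-1. *)
have trN : \tr N = - \tr N.
  rewrite -[in LHS](mulmxK form_unitmx N) -mxtrace_tr trmx_mul skN trmx_inv.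
  by rewrite B_sym mulmxN linearN/= mxtrace_mulC mulmxK ?form_unitmx.
lra.
Qed.

End bilinear_form.

Section semi_symmetric_curvature.
Context {R : realType} {n : nat} {M : topologicalType}.
Variables (A : smooth_manifold R n M) (g : M -> 'M[R]_n).
Hypothesis metric_g : riemannian_metric A g.
Variable D : (M -> 'rV[R]_n) -> (M -> 'rV[R]_n) -> M -> 'rV[R]_n.
Hypothesis lcD : levi_civita A g D.
Variables (pi : M -> 'cV[R]_n) (P : M -> 'rV[R]_n).
Hypothesis sP : vector_field A P.
Hypothesis P_pi : forall X, vector_field A X ->
  forall p, inner g X P p = pairing pi X p.

Let affD := levi_civita_connection lcD.

Local Notation G p := (form (g p)).
Local Notation Dbar := (semi_symmetric g pi P D).

Lemma derivation_cst X (a : R) p : derivation A X (fun=> a) p = 0.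
Proof. exact: derive_cst. Qed.

(** Only sums and multiples by functions appear on the right, the sign being the constant function
    -1, to match the axioms of a connection. *)
Lemma semi_symmetricE X Y : vector_field A Y ->
  Dbar X Y = (fun q => D X Y q + (inner g Y P q *: X q +
    inner g X Y q *: (-1 *: P q))).
Proof.
move=> sY; apply/funext => q; rewrite /semi_symmetric P_pi//.
by rewrite scaleN1r scalerN addrA.
Qed.

Lemma vector_field_semi_symmetric X Y : vector_field A X -> vector_field A Y ->
  vector_field A (Dbar X Y).
Proof.
move=> sX sY; rewrite semi_symmetricE//; apply: vector_fieldD.
  exact: (connection_smooth affD).
apply: vector_fieldD; apply: vector_fieldZ => //;
  try exact: (smooth_inner metric_g).
by apply: vector_fieldZ => //; exact: smooth_function_cst.
Qed.

(** The Leibniz rule is applied to each term, and the derivatives of the coefficients g(Z, P) and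
    g(Y, Z) are expanded by metric compatibility. *)
Lemma connection_semi_symmetric X Y Z p :
  vector_field A X -> vector_field A Y -> vector_field A Z ->
  D X (Dbar Y Z) p = D X (D Y Z) p +
    ((G p (D X Z p) (P p) + G p (Z p) (D X P p)) *: Y p +
     G p (Z p) (P p) *: D X Y p) -
    ((G p (D X Y p) (Z p) + G p (Y p) (D X Z p)) *: P p +
     G p (Y p) (Z p) *: D X P p).
Proof.
move=> sX sY sZ; rewrite semi_symmetricE//.
have sN : vector_field A (fun q => -1 *: P q).
  by apply: vector_fieldZ => //; exact: smooth_function_cst.
have sZP := smooth_inner metric_g sZ sP.
have sYZ := smooth_inner metric_g sY sZ.
rewrite (connection_addr affD)//; last 2 first.
- exact: (connection_smooth affD).
- by apply: vector_fieldD; apply: vector_fieldZ.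
rewrite (connection_addr affD)//; try exact: vector_fieldZ.
rewrite !(connection_leibniz affD)//; last exact: smooth_function_cst.
rewrite derivation_cst scale0r add0r.
rewrite !(levi_civita_metric lcD)// !scaleN1r !scalerN.
by rewrite -opprD addrA.
Qed.

(** Torsion-freeness replaces the bracket in the algebraic terms by D_X Y - D_Y X, which cancels the
    first derivatives of the arguments; D_[X,Y] Z occurs in both curvatures. What remains is an
    identity between coordinates. *)
Lemma curvature_semi_symmetric X Y Z p :
  vector_field A X -> vector_field A Y -> vector_field A Z ->
  curvature A Dbar X Y Z p = curvature A D X Y Z p
  + G p (Z p) (D X P p) *: Y p - G p (Z p) (D Y P p) *: X p
  - G p (Y p) (Z p) *: D X P p + G p (X p) (Z p) *: D Y P p
  + (G p (Z p) (P p) * G p (Y p) (P p)) *: X p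
  - (G p (Z p) (P p) * G p (X p) (P p)) *: Y p
  - (G p (Y p) (Z p) * G p (P p) (P p)) *: X p
  + (G p (X p) (Z p) * G p (P p) (P p)) *: Y p
  + (G p (Y p) (Z p) * G p (X p) (P p)) *: P p
  - (G p (X p) (Z p) * G p (Y p) (P p)) *: P p.
Proof.
move=> sX sY sZ.
have DbarE V W : vector_field A W -> Dbar V W p =
    D V W p + (G p (W p) (P p) *: V p - G p (V p) (W p) *: P p).
  by move=> sW; rewrite /semi_symmetric -P_pi// addrA.
have sYZ := vector_field_semi_symmetric sY sZ.
have sXZ := vector_field_semi_symmetric sX sZ.
rewrite /curvature (DbarE _ _ sYZ) (DbarE _ _ sXZ).
rewrite (DbarE (lie_bracket A X Y) Z sZ).
rewrite !connection_semi_symmetric// -(levi_civita_torsion_free lcD)//.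
rewrite (DbarE Y Z sZ) (DbarE X Z sZ).
have gC := formC (Defs.metric_sym metric_g p).
rewrite !(formDl, formDr, formZl, formZr, formNl, formNr).
rewrite (gC (Y p) (X p)).
by apply/rowP => j; rewrite !mxE; ring.
Qed.

End semi_symmetric_curvature.

(** * Trace of the curvature and its symmetrization *)

Section ricci_semi_symmetric.
Context {R : realType} {n : nat} {M : topologicalType}.
Variables (A : smooth_manifold R n M) (g : M -> 'M[R]_n).
Hypothesis metric_g : riemannian_metric A g.
Variable D : (M -> 'rV[R]_n) -> (M -> 'rV[R]_n) -> M -> 'rV[R]_n.
Hypothesis lcD : levi_civita A g D.
Variables (pi : M -> 'cV[R]_n) (P : M -> 'rV[R]_n).
Hypothesis sP : vector_field A P.
Hypothesis P_pi : forall X, vector_field A X ->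
  forall p, inner g X P p = pairing pi X p.
Hypothesis killing_P : killing A g D P.

Local Notation G p := (form (g p)).
Local Notation Dbar := (semi_symmetric g pi P D).

Lemma ricciE D' Y Z p :
  ricci A D' Y Z p = \sum_i curvature A D' (extension A p 'e_i) Y Z p 0 i.
Proof. by apply: eq_bigr => i _; rewrite mxE. Qed.

Lemma ricci_semi_symmetric Y Z p : vector_field A Y -> vector_field A Z ->
  ricci A Dbar Y Z p = ricci A D Y Z p - (n%:R - 2) *
    (G p (D Y P p) (Z p) + G p (Y p) (Z p) * G p (P p) (P p)
     - G p (Y p) (P p) * G p (Z p) (P p)).
Proof.
move=> sY sZ; pose E i := extension A p 'e_i.
have sE i : vector_field A (E i) by have [] := extensionP A p 'e_i.
have Ep i : E i p = 'e_i by have [] := extensionP A p 'e_i.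
have gC := formC (Defs.metric_sym metric_g p).
have kil X X' : vector_field A X -> vector_field A X' ->
    G p (D X P p) (X' p) = - G p (D X' P p) (X p).
  by move=> sX sX'; apply/eqP; rewrite -addr_eq0; apply/eqP; exact: killing_P.
have divP : \sum_i D (E i) P p 0 i = 0.
  apply: (trace_skew (Defs.metric_sym metric_g p)
    (@metric_pos _ _ _ _ _ metric_g p)).
  by move=> i j; rewrite -!Ep; exact: killing_P.
have sumd (u w : 'rV[R]_n) : \sum_i G p (E i p) w * u 0 i = G p u w.
  by under eq_bigr do rewrite Ep; exact: sum_form_delta.
have sum1 : \sum_i E i p 0 i = n%:R.
  under eq_bigr do rewrite Ep mxE !eqxx.
  by rewrite sumr_const card_ord.
rewrite !ricciE.
(* The Killing equation makes X |-> g(Z, D_X P) linear in the value of X,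
   so that no tensoriality of D in its first argument is needed. *)
pose T i := - (G p (E i p) (D Z P p) * Y p 0 i)
  + (G p (Z p) (P p) * G p (Y p) (P p) - G p (Y p) (Z p) * G p (P p) (P p)
     - G p (Z p) (D Y P p)) * E i p 0 i
  - G p (Y p) (Z p) * D (E i) P p 0 i + G p (E i p) (Z p) * D Y P p 0 i
  - G p (Z p) (P p) * (G p (E i p) (P p) * Y p 0 i)
  + G p (P p) (P p) * (G p (E i p) (Z p) * Y p 0 i)
  + G p (Y p) (Z p) * (G p (E i p) (P p) * P p 0 i)
  - G p (Y p) (P p) * (G p (E i p) (Z p) * P p 0 i).
transitivity (\sum_i (curvature A D (E i) Y Z p 0 i + T i)).
  apply: eq_bigr => i _.
  rewrite (curvature_semi_symmetric metric_g lcD sP P_pi p (sE i) sY sZ) /T.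
  rewrite (gC (Z p) (D (E i) P p)) (kil _ _ (sE i) sZ) (gC (E i p) (D Z P p)).
  by rewrite !mxE; ring.
rewrite big_split /=; congr (_ + _).
(* Each of g(D_Y P, Z), |P|^2 g(Y, Z) and pi(Y) pi(Z) occurs n times through the trace of the
   identity and twice, with the opposite sign, through rank-one terms: hence the factor n - 2. *)
rewrite /T !(big_split, sumrN) /= -!mulr_sumr !sumd divP sum1.
rewrite (gC (Y p) (D Z P p)) (kil _ _ sZ sY) (gC (Z p) (D Y P p)).
rewrite (gC (P p) (Z p)).
by ring.
Qed.

Lemma sym_ricci_semi_symmetric Y Z p : vector_field A Y -> vector_field A Z ->
  sym_ricci A Dbar Y Z p = sym_ricci A D Y Z p
    - (n%:R - 2) * inner g P P p * inner g Y Z p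
    + (n%:R - 2) * pairing pi Y p * pairing pi Z p.
Proof.
move=> sY sZ; rewrite /sym_ricci !ricci_semi_symmetric// -!P_pi//.
have -> : G p (D Z P p) (Y p) = - G p (D Y P p) (Z p).
  by apply/eqP; rewrite -addr_eq0; apply/eqP; exact: killing_P.
rewrite (formC (Defs.metric_sym metric_g p) (Z p) (Y p)).
by rewrite /inner -!/(form _ _ _); field.
Qed.

End ricci_semi_symmetric.

(** * The Einstein case: form and non-vanishing of the symmetrized Ricci tensor *)

Theorem theorem3p1 (R : realType) (n : nat) (n_ge3 : (3 <= n)%N)
    (M : topologicalType) (A : smooth_manifold R n M)
    (g : M -> 'M[R]_n) (metric_g : riemannian_metric A g)
    (nabla : (M -> 'rV[R]_n) -> (M -> 'rV[R]_n) -> M -> 'rV[R]_n)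
    (levi_civita_nabla : levi_civita A g nabla)
    (pi : M -> 'cV[R]_n) (one_form_pi : one_form A pi)
    (P : M -> 'rV[R]_n) (vector_field_P : vector_field A P)
    (P_pi : forall X, vector_field A X ->
       forall p, inner g X P p = pairing pi X p)
    (nondegenerate :
       ~ ((forall p, pi p = 0) /\ vanishing A (ricci A nabla)))
    (killing_P : killing A g nabla P)
    (einstein_nabla : einstein A g nabla) :
  semi_quasi_einstein A g (semi_symmetric g pi P nabla).
Proof.
have [a0 sa0 ricE] := einstein_nabla.
pose c : R := n%:R - 2; have c0 : 0 < c by rewrite subr_gt0 ltr_nat.
pose a p := a0 p + - c * inner g P P p.
have gC p := formC (Defs.metric_sym metric_g p).
have SE Y Z p : vector_field A Y -> vector_field A Z ->
    sym_ricci A (semi_symmetric g pi P nabla) Y Z p =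
    a p * inner g Y Z p + c * pairing pi Y p * pairing pi Z p.
  move=> sY sZ; rewrite (sym_ricci_semi_symmetric metric_g levi_civita_nabla)//.
  rewrite /sym_ricci !ricE// /a /inner -!/(form _ _ _) (gC p (Z p) (Y p)) -/c.
  by field.
have sa : smooth_function A a.
  apply: smooth_functionD => //; apply: smooth_functionM.
    exact: smooth_function_cst.
  exact: smooth_inner.
(* Extending [v] to a field turns the duality of [pi] and [P], given on fields, into one on vectors
   at [p]. *)
have piE p v : (v *m pi p) 0 0 = form (g p) v (P p).
  have [sX Xp] := extensionP A p v.
  by have := P_pi _ sX p; rewrite /inner /pairing Xp => <-.
have posg p v : v != 0 -> 0 < form (g p) v v.
  exact: (metric_pos metric_g).
split=> //.
- move=> S0.
  have Q p u v : a p * form (g p) u v +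
      c * form (g p) u (P p) * form (g p) v (P p) = 0.
    have [[sX Xp] [sY Yp]] := (extensionP A p u, extensionP A p v).
    have := S0 _ _ sX sY p; rewrite SE// -!P_pi//.
    by rewrite /inner Xp Yp.
  have P0 p : P p = 0.
    (* The column [pi p] has rank at most 1 < n, so its kernel contains a nonzero vector. *)
    have [w wP w0] : exists2 w, form (g p) w (P p) = 0 & w != 0.
      have : kermx (pi p) != 0.
        rewrite -mxrank_eq0 mxrank_ker subn_eq0 -ltnNge.
        by apply: leq_ltn_trans (rank_leq_col _) _; apply: leq_trans n_ge3.
      case/rowV0Pn => w /sub_kermxP wpi w0; exists w => //.
      by rewrite -piE wpi mxE.
    have a0p : a p = 0.
      apply/eqP; move/eqP: (Q p w w); rewrite wP mulr0 addr0 mulf_eq0.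
      by rewrite [form _ w w == 0]gt_eqF ?orbF// posg.
    (* With a = 0, the value at (P, P) is c |P|^4, positive if P is nonzero. *)
    apply/eqP/negPn/negP => Pp0; move/eqP: (Q p (P p) (P p)).
    rewrite a0p mul0r add0r gt_eqF//.
    by rewrite !mulr_gt0// posg.
  apply: nondegenerate; split=> [p|Y Z sY sZ p].
    apply/matrixP => i j; rewrite !ord1 [RHS]mxE.
    have := piE p 'e_i; rewrite P0 -rowE mxE => ->.
    by rewrite /form trmx0 mulmx0 mxE.
  rewrite ricE//; have := Q p (Y p) (Z p).
  by rewrite /a /inner P0 /form trmx0 !mulmx0 !mxE !mulr0 !addr0.
(* If [pi] is nonzero somewhere, b = n - 2 and eta = [pi] give the required form. *)
- have [[p pip]|pi_eq0] := pselect (exists p, pi p != 0).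
    exists a, (fun=> c), pi; split=> //; first exact: smooth_function_cst.
      by exists p.
    by move=> Y Z sY sZ q; exact: SE.
  have pi0 q : pi q = 0 by apply/eqP/negPn/negP => piq; apply: pi_eq0; exists q.
  (* When pi = 0 the coefficient b is 0 and eta is arbitrary: it is the metric
     dual of any vector field which does not vanish identically. *)
  have [Z [sZ [p Zp]]] : exists Z, vector_field A Z /\ exists p, Z p != 0.
    (* If every field vanished identically, S = a0 g would vanish on fields; together with pi = 0
       this is the excluded case. *)
    apply: contra_notP nondegenerate => noZ; split=> // Y Z sY sZ p.
    rewrite ricE// /inner.
    have [->|Zp] := eqVneq (Z p) 0; first by rewrite trmx0 mulmx0 mxE mulr0.
    by exfalso; apply: noZ; exists Z; split=> //; exists p.
  exists a, (fun=> 0), (fun p => g p *m (Z p)^T); split=> //.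
  + exact: smooth_function_cst.
  + exact: one_form_flat.
  + exists p; apply/negP => /eqP gZ; have := posg p (Z p) Zp.
    by rewrite /form -mulmxA gZ mulmx0 mxE ltxx.
  + move=> Y Y' sY sY' q; rewrite SE// /pairing pi0 !mulmx0 !mxE.
    by rewrite !mulr0 !mul0r.
Qed.
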